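(* Let $h_{ij}$ be the probability density function of $$x_{ij}(t+1)=\tfrac13\sum_{k=1}^3 p_{kj}+\tfrac13\sum_{k=1}^3 A_{kj}\,|C_{kj}p_{kj}-x_{ij}|,$$ where $p_{1j},p_{2j},p_{3j},x_{ij}$ are fixed reals and $A_{kj}\sim U[-a,a]$, $C_{kj}\sim U[0,2]$ ($k=1,2,3$) are all independent. Let $m_{kj}=a(-|p_{kj}|+|x_{ij}-p_{kj}|)$ and $n_{kj}=a(|p_{kj}|+|x_{ij}-p_{kj}|)$, with $n_{kj}>0$ for $k=1,2,3$. If at least one of $m_{1j},m_{2j},m_{3j}$ is positive, then $h_{ij}$ is differentiable on $\mathbb{R}$, and $$h_{ij}'\Bigl(\tfrac13(p_{1j}+p_{2j}+p_{3j})\Bigr)=0.$$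
   Context: Setting: coordinate $j$ of one update step of the grey wolf optimizer, with $a=a(t)=2(1-t/T)>0$ at iteration $1\le t<T$; the coordinates of the three best search agents and of the current position of agent $i$ are constants. $U[p,q]$ is the uniform distribution on $[p,q]$. Densities are defined up to null sets; the statement concerns the version of $h_{ij}$ given by the (everywhere defined) scaled convolution $u\mapsto 3(g_{1j}*g_{2j}*g_{3j})(3u)$, where $g_{kj}$ is the density of $p_{kj}+A_{kj}|C_{kj}p_{kj}-x_{ij}|$. *)

(* Defs.v *)
From HB Require Import structures.
From mathcomp Require Import all_boot all_order all_algebra.
From mathcomp Require Import all_classical all_reals all_analysis.
From mathcomp Require Import measurable_realfun.

Set Implicit Arguments.
Unset Strict Implicit.
Unset Printing Implicit Defensive.

Import Order.TTheory GRing.Theory Num.Theory.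
Import numFieldNormedType.Exports.

Local Open Scope classical_set_scope.
Local Open Scope ring_scope.

(* The laws are compared on measurable sets only: [distribution] and
   [uniform_prob] are total functions on sets, with unrelated values on
   non-measurable ones. *)
Definition has_uniform_law d (T : measurableType d) (R : realType)
    (P : probability T R) (X : {RV P >-> R}) (p q : R) : Prop :=
  exists pq : p < q, forall B : set R, measurable B ->
    distribution P X B = uniform_prob pq B.

Definition mutually_independent d (T : measurableType d) (R : realType)
    (P : probability T R) (I : finType) (X : I -> {RV P >-> R}) : Prop :=
  forall (J : {set I}) (B : I -> set R),
    (forall i, i \in J -> measurable (B i)) ->
    P (\bigcap_(i in [set` J]) (X i @^-1` B i)) =
    (\prod_(i in J) P (X i @^-1` B i))%E.

(* Densities may take the value +oo (the density of A |C p - x| has a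
   logarithmic singularity when m <= 0). *)
Definition is_pdf d (T : measurableType d) (R : realType)
    (P : probability T R) (X : T -> R) (f : R -> \bar R) : Prop :=
  [/\ measurable_fun setT f,
      forall y, (0 <= f y)%E &
      forall B : set R, measurable B ->
        P (X @^-1` B) = (\int[lebesgue_measure]_(y in B) f y)%E].

Definition convolution (R : realType) (f g : R -> \bar R) (u : R) : \bar R :=
  (\int[lebesgue_measure]_y (f (u - y)%R * g y))%E.

Definition convolution3 (R : realType) (g : 'I_3 -> R -> \bar R) :
    R -> \bar R :=
  convolution (convolution (g 0) (g 1)) (g 2).

Definition gwo_a (R : realType) (t tmax : nat) : R :=
  2 * (1 - t%:R / tmax%:R).

Definition gwo_m (R : realType) (a p x : R) : R := a * (- `|p| + `|x - p|).

Definition gwo_n (R : realType) (a p x : R) : R := a * (`|p| + `|x - p|).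

Definition gwo_term (T : Type) (R : realType) (A C : T -> R) (p x : R)
    (w : T) : R :=
  p + A w * `|C w * p - x|.

Definition gwo_next (T : Type) (R : realType) (A C : 'I_3 -> T -> R)
    (p : 'I_3 -> R) (x : R) (w : T) : R :=
  3^-1 * (\sum_(k < 3) p k) + 3^-1 * (\sum_(k < 3) A k w * `|C k w * p k - x|).

(* Main.v *)
Require Import Defs.
From HB Require Import structures.
From mathcomp Require Import all_boot all_order all_algebra.
From mathcomp Require Import all_classical all_reals all_analysis.
From mathcomp Require Import measurable_realfun.
From mathcomp Require Import ring lra.

Set Implicit Arguments.
Unset Strict Implicit.
Unset Printing Implicit Defensive.

Import Order.TTheory GRing.Theory Num.Theory.
Import numFieldNormedType.Exports.

Local Open Scope classical_set_scope.
Local Open Scope ring_scope.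

(** Write [V = |C p - x|] for the random factor of one term.  Given [C], the
    term [p + A V] is uniform on the interval of centre [p] and half-width
    [r = a V], so its law is a mixture of centred uniform laws
    ([gwo_term_mixture]).  Convolving a function [phi] with the density of such
    a mixture is the same as averaging, over [c], the means of [phi] over the
    intervals of half-width [r c] ([uniform_mixture_convolution]): this formula
    only sees the law, so it holds at every point and for every version of the
    density.

    Although the density of a term is unbounded near its centre when
    [m <= 0], the hypothesis [n > 0] makes [r^(-1/2)] integrable: either [p]
    vanishes and [r] is a positive constant, or [c |-> c p - x] is affine with
    nonzero slope and [|y|^(-1/2)] is integrable near [0].  Hence a term gives mass at most
    [K s^(1/2)] to an interval of half-width [s] ([uniform_mixture_mass_le]),
    and the mean of its density over such an interval is at most
    [K s^(-1/2) / 2].  The convolution [gam] of two densities averages these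
    means over the radii of the other term, so by dominated convergence it is
    finite, bounded and continuous ([convolution_uniform_mixtures]).

    Convolving [gam] with the term for which [m > 0] gains a derivative: there
    the radii are at least [m], an interval mean of a continuous function is a
    difference quotient of one of its primitives, and differentiation under the
    integral sign applies ([convolution_derivable]).  Commutativity of the
    convolution lets that term be the last of the three factors.

    Finally interval means commute with reflections, so the triple convolution
    is symmetric about [p_1 + p_2 + p_3].  Thus [h] is symmetric about the point
    where its derivative is evaluated, and the derivative of a function
    symmetric about a point vanishes there ([derive1_even]). *)

(** * Affine changes of variable for the Lebesgue measure *)

Lemma lebesgue_measure_affine (R : realType) (s b : R) (A : set R) :
  s != 0 -> measurable A ->
  lebesgue_measure ((fun y => s * y + b) @^-1` A) =
  (`|s|^-1%:E * lebesgue_measure A)%E.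
Proof.
move=> s0 mA.
pose phi : measurableTypeR R -> measurableTypeR R := fun y => s * y + b.
have mphi : measurable_fun [set: measurableTypeR R] phi.
  apply: measurable_funD; last exact: measurable_cst.
  exact: measurable_funM.
pose nu := pushforward (@lebesgue_measure R) phi :
  {measure set (measurableTypeR R) -> \bar R}.
have ns0 : 0 <= `|s| by [].
pose nu' : {measure set (measurableTypeR R) -> \bar R} :=
  mscale (NngNum ns0) (nu mphi).
have E : lebesgue_measure A = nu' A.
  apply: lebesgue_measure_unique => // _ [[u v] _ <-] /=.
  rewrite /mscale /= /nu /pushforward /=.
  have [sp|sn|s00] := ltrgtP s 0; last by rewrite s00 eqxx in s0.
  - rewrite [X in (_ * lebesgue_measure X)%E]
        (_ : _ = `[(v - b) / s, (u - b) / s[%classic); last first.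
      apply/seteqP; split => y /=; rewrite /phi !in_itv /= => /andP[h1 h2];
        apply/andP; split.
      + by rewrite ler_ndivrMr // mulrC lerBrDr.
      + by rewrite ltr_ndivlMr // mulrC ltrBlDr.
      + by move: h2; rewrite ltr_ndivlMr // mulrC ltrBlDr.
      + by move: h1; rewrite ler_ndivrMr // mulrC lerBrDr.
    rewrite !lebesgue_measure_itv /= !lte_fin.
    rewrite ltr_nM2r ?invr_lt0 // ltrD2r; case: ifPn => _; last by rewrite mule0.
    rewrite -!EFinB -EFinM ltr0_norm //; congr EFin; by field.
  - rewrite [X in (_ * lebesgue_measure X)%E]
        (_ : _ = `](u - b) / s, (v - b) / s]%classic); last first.
      apply/seteqP; split => y /=; rewrite /phi !in_itv /= => /andP[h1 h2];
        apply/andP; split.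
      + by rewrite ltr_pdivrMr // mulrC ltrBlDr.
      + by rewrite ler_pdivlMr // mulrC lerBrDr.
      + by move: h1; rewrite ltr_pdivrMr // mulrC ltrBlDr.
      + by move: h2; rewrite ler_pdivlMr // mulrC lerBrDr.
    rewrite !lebesgue_measure_itv /= !lte_fin.
    rewrite ltr_pM2r ?invr_gt0 // ltrD2r; case: ifPn => _; last by rewrite mule0.
    rewrite -!EFinB -EFinM gtr0_norm //; congr EFin; by field.
rewrite [in RHS]E /mscale /= muleA -EFinM mulVf ?mul1e //.
by rewrite normr_eq0.
Qed.

Lemma ge0_integral_affine (R : realType) (s b : R) (f : R -> \bar R) :
  s != 0 -> measurable_fun setT f -> (forall y, 0 <= f y)%E ->
  (\int[lebesgue_measure]_y f (s * y + b)%R =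
   `|s|^-1%:E * \int[lebesgue_measure]_y f y)%E.
Proof.
move=> s0 mf f0.
pose phi : measurableTypeR R -> measurableTypeR R := fun y => s * y + b.
have mphi : measurable_fun [set: measurableTypeR R] phi.
  apply: measurable_funD; last exact: measurable_cst.
  exact: measurable_funM.
have s1 : 0 <= `|s|^-1 by rewrite invr_ge0.
rewrite -(ge0_integral_pushforward mphi lebesgue_measure measurableT mf) //.
rewrite -(ge0_integral_mscale lebesgue_measure measurableT (NngNum s1)) //.
apply: eq_measure_integral => A mA _.
by rewrite /= /mscale /= /pushforward lebesgue_measure_affine.
Qed.

(** * Densities and interval means *)

Section density.
Context d (T : measurableType d) (R : realType) (P : probability T R).
Variables (X : T -> R) (g : R -> \bar R).
Hypothesis mX : measurable_fun setT X.
Hypothesis gX : is_pdf P X g.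

(** [g] agrees almost everywhere with the Radon-Nikodym derivative of the law of
    [X], and that derivative satisfies the change of variables formula. *)
Lemma ge0_integral_pdf (phi : R -> \bar R) :
  measurable_fun setT phi -> (forall y, 0 <= phi y)%E ->
  (\int[lebesgue_measure]_y (phi y * g y) = \int[P]_w phi (X w))%E.
Proof.
move=> mphi phi0.
pose X' : {mfun T >-> measurableTypeR R} :=
  HB.pack X (isMeasurableFun.Build _ _ T (measurableTypeR R) X mX).
pose nu : {finite_measure set (measurableTypeR R) -> \bar R} :=
  distribution P X'.
have [mg g0 gE] := gX.
have numu : nu `<< (@lebesgue_measure R).
  apply/null_content_dominatesP => A mA muA.
  rewrite /nu /= /distribution /pushforward /= gE //.
  by apply: null_set_integral => //; exact: measurable_funTS.
have -> : (\int[P]_w phi (X w) = \int[nu]_y phi y)%E.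
  by rewrite /nu /= ge0_integral_distribution.
rewrite -(Radon_Nikodym_SigmaFinite.change_of_variables numu) //.
apply: ge0_ae_eq_integral => //.
- exact: emeasurable_funM.
- apply: emeasurable_funM => //.
  exact/(measurable_int _ (Radon_Nikodym_SigmaFinite.f_integrable _)).
- by move=> y _; rewrite mule_ge0.
- by move=> y _; rewrite mule_ge0 // Radon_Nikodym_SigmaFinite.f_ge0.
apply: ae_eqe_mul2l.
apply/ae_eq_sym/integral_ae_eq => //.
  exact: Radon_Nikodym_SigmaFinite.f_integrable.
move=> E _ mE; rewrite -Radon_Nikodym_SigmaFinite.f_integral // -gE //.
Qed.
End density.
Section independent_pair.
Context d (T : measurableType d) (R : realType) (P : probability T R).
Variables (X Y : {RV P >-> R}) (a b c e : R) (ab : a < b) (ce : c < e).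
Hypothesis hX : forall B, measurable B -> distribution P X B = uniform_prob ab B.
Hypothesis hY : forall B, measurable B -> distribution P Y B = uniform_prob ce B.
Hypothesis hXY : forall B D, measurable B -> measurable D ->
  P (X @^-1` B `&` Y @^-1` D) = (P (X @^-1` B) * P (Y @^-1` D))%E.

Lemma ge0_integral_uniform_pair (f : R * R -> \bar R) :
  measurable_fun setT f -> (forall z, 0 <= f z)%E ->
  (\int[P]_w f (X w, Y w) =
   \int[uniform_prob ce]_y \int[uniform_prob ab]_x f (x, y))%E.
Proof.
move=> mf f0.
pose XY : T -> measurableTypeR R * measurableTypeR R := fun w => (X w, Y w).
have mXY : measurable_fun setT XY.
  apply: measurable_fun_pair.
    exact: (measurable_funPT X).
  exact: (measurable_funPT Y).
pose nu := pushforward P XY :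
  {measure set (measurableTypeR R * measurableTypeR R) -> \bar R}.
transitivity (\int[nu mXY]_z f z)%E.
  by rewrite ge0_integral_pushforward.
rewrite -(fubini_tonelli2 (m1 := uniform_prob ab) (m2 := uniform_prob ce) f mf f0).
apply: eq_measure_integral => A mA _.
apply/esym/product_measure_unique => // B D mB mD.
rewrite /= -(hX mB) -(hY mD) /distribution /pushforward /=.
by rewrite -hXY //; congr (P _); apply/seteqP; split.
Qed.
End independent_pair.

(** At [r = 0] the value is [0] because [0^-1 = 0]; this convention keeps the
    bounds below valid for every [r >= 0]. *)
Definition interval_mean (R : realType) (phi : R -> \bar R) (p r : R) : \bar R :=
  ((2 * r)^-1%:E * \int[lebesgue_measure]_(y in `[(p - r)%R, (p + r)%R]) phi y)%E.

Lemma uniform_mean_affine (R : realType) (a v p : R) (phi : R -> \bar R)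
    (aa : - a < a) : 0 < v ->
  measurable_fun setT phi -> (forall y, 0 <= phi y)%E ->
  (\int[uniform_prob aa]_s phi (p + s * v)%R = interval_mean phi p (a * v))%E.
Proof.
move=> v0 mphi phi0.
have a0 : 0 < a by move: aa; rewrite -subr_gt0 opprK -mulr2n pmulrn_lgt0.
have maff : measurable_fun [set: R] (fun s : R => p + s * v).
  by apply: measurable_funD => //; apply: measurable_funM.
rewrite integral_uniform //; last exact: (measurableT_comp mphi).
pose F := (phi \_ `[p - a * v, p + a * v]%classic).
have mF : measurable_fun [set: R] F.
  by apply/(measurable_restrictT _ _).1 => //; exact: measurable_funTS.
have F0 y : (0 <= F y)%E by rewrite /F patchE; case: ifP.
rewrite /interval_mean [in RHS]integral_mkcond -/F.
have := ge0_integral_affine p (lt0r_neq0 v0) mF F0.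
rewrite [in X in X -> _](_ : (fun y => F (v * y + p)) =
   (fun s => phi (p + s * v)) \_ `[(- a)%R, a]%classic); last first.
  apply/funext => s; rewrite /F !patchE !mem_setE !in_itv /=.
  rewrite (addrC (v * s)) (mulrC v) -mulNr !lerD2l !ler_pM2r //.
rewrite -integral_mkcond => ->.
rewrite muleA -EFinM gtr0_norm // opprK invfM; congr (_%:E * _)%E.
by field; rewrite !lt0r_neq0 ?addr_gt0.
Qed.

(** On nonnegative reals the inverse is the power of exponent [-1], including at
    [0], and powers are measurable. *)
Lemma measurable_fun_ge0_inv d (Y : measurableType d) (R : realType) (r : Y -> R) :
  (forall c, 0 <= r c) -> measurable_fun setT r ->
  measurable_fun setT (fun c => (r c)^-1).
Proof.
move=> r0 mr.
rewrite (_ : (fun _ => _) = (fun c => r c `^ (-1))).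
  exact: (measurableT_comp (measurable_powR _)).
by apply/funext => c; rewrite powR_inv1.
Qed.

Lemma measurable_interval_mean d (Y : measurableType d) (R : realType)
    (r : Y -> R) (phi : R -> \bar R) (p : R) :
  (forall c, 0 <= r c) -> measurable_fun setT r ->
  measurable_fun setT phi -> (forall y, 0 <= phi y)%E ->
  measurable_fun setT (fun c => interval_mean phi p (r c)).
Proof.
move=> r0 mr mphi phi0.
apply: emeasurable_funM.
  apply/measurable_EFinP; apply: measurable_fun_ge0_inv => [c|]; first by rewrite mulr_ge0.
  exact: measurable_funM.
under eq_fun do rewrite integral_mkcond.
pose F (z : Y * measurableTypeR R) :=
  if (p - r z.1 <= z.2) && (z.2 <= p + r z.1) then phi z.2 else 0%E.
have mF : measurable_fun setT F.
  have mr1 : measurable_fun setT (fun z : Y * measurableTypeR R => r z.1).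
    exact: measurableT_comp.
  apply: measurable_fun_ifT => //=; last exact: measurableT_comp.
  apply: measurable_and; apply: measurable_fun_ler => //.
    exact: measurable_funB.
  exact: measurable_funD.
have F0 z : (0 <= F z)%E by rewrite /F; case: ifP.
have := @measurable_fun_fubini_tonelli_F _ _ Y (measurableTypeR R) R
  lebesgue_measure F mF F0.
apply: eq_measurable_fun => c _; rewrite /fubini_F.
by apply: eq_integral => y _; rewrite patchE mem_setE in_itv.
Qed.

Lemma interval_mean_ge0 (R : realType) (phi : R -> \bar R) (p r : R) :
  0 <= r -> (forall y, 0 <= phi y)%E -> (0 <= interval_mean phi p r)%E.
Proof.
move=> r0 phi0; apply: mule_ge0; last exact: integral_ge0.
by rewrite lee_fin invr_ge0 mulr_ge0.
Qed.

(** The law with density [g] is the mixture over [c ~ mu] of the uniform laws on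
    [[p - r c, p + r c]].  It is expressed by its action on test functions, so
    that it does not depend on the version of the density. *)
Definition uniform_mixture d (Y : measurableType d) (R : realType)
    (mu : probability Y R) (r : Y -> R) (p : R) (g : R -> \bar R) : Prop :=
  [/\ measurable_fun setT g, forall y, (0 <= g y)%E,
      measurable_fun setT r, forall c, 0 <= r c &
      forall phi : R -> \bar R,
        measurable_fun setT phi -> (forall y, 0 <= phi y)%E ->
        (\int[lebesgue_measure]_y (phi y * g y) =
         \int[mu]_c interval_mean phi p (r c))%E].
(** * The law of one term *)

(** [2 * sqrt] is a primitive away from [0]; exhaust [`]0, L]] by the intervals
    [[L / (n + 2), L]], on which the integrals stay below [2 * sqrt L]. *)
Lemma integral_inv_sqrt_lt_pinfty (R : realType) (L : R) : 0 < L ->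
  (\int[lebesgue_measure]_(y in `]0%R, L]) ((Num.sqrt y)^-1)%:E < +oo)%E.
Proof.
move=> L0.
pose E n := `[L / n.+2%:R, L]%classic.
have E_lt n : L / n.+2%:R < L by rewrite ltr_pdivrMr // ltr_pMr // ltr1n.
have E0 n : 0 < L / n.+2%:R by rewrite divr_gt0.
have UE : \bigcup_n E n = `]0, L]%classic.
  apply/seteqP; split => [y [n _]|y]; rewrite /E /= !in_itv /= => /andP[h1 h2].
    by rewrite h2 (lt_le_trans _ h1).
  exists (Num.truncn (L / y)) => //=; rewrite in_itv /= h2 andbT.
  rewrite ler_pdivrMr // mulrC -ler_pdivrMr //.
  rewrite (le_trans (ltW (truncnS_gt _))) // ler_nat.
  by [].
have mf (D : set R) : measurable D ->
    measurable_fun D (fun y : R => ((Num.sqrt y)^-1)%:E).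
  move=> mD; apply/measurable_EFinP/measurable_funTS.
  apply: measurable_fun_ge0_inv; first by move=> c; rewrite sqrtr_ge0.
  apply: continuous_measurable_fun; exact: sqrt_continuous.
have EE n : (\int[lebesgue_measure]_(y in E n) ((Num.sqrt y)^-1)%:E <=
    (2 * Num.sqrt L)%:E)%E.
  rewrite (@continuous_FTC2 _ _ (fun y => 2 * Num.sqrt y)) //.
  - by rewrite -EFinB lee_fin lerBlDr lerDl mulr_ge0 // sqrtr_ge0.
  - apply: continuous_in_subspaceT => y; rewrite inE /= in_itv /= => /andP[yE _].
    have y0 := lt_le_trans (E0 n) yE.
    apply: cvgV; first by rewrite sqrtr_eq0 -ltNge.
    exact: sqrt_continuous.
  - split.
    + move=> y; rewrite in_itv /= => /andP[yE _].
      have y0 := lt_trans (E0 n) yE.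
      apply: derivableM => //.
      by have := is_derive1_sqrt y0; case.
    + apply: cvg_at_right_filter; apply: cvgM; first exact: cvg_cst.
      exact: sqrt_continuous.
    + apply: cvg_at_left_filter; apply: cvgM; first exact: cvg_cst.
      exact: sqrt_continuous.
  - move=> y; rewrite in_itv /= => /andP[yE _].
    have y0 := lt_trans (E0 n) yE.
    have h := is_derive1_sqrt y0.
    rewrite derive1E derive_val /GRing.scale /=.
    by rewrite invfM mulrA divff ?mul1r ?pnatr_eq0.
have := @ge0_nondecreasing_set_cvg_integral _ (measurableTypeR R) R E
  (fun y => ((Num.sqrt y)^-1)%:E) lebesgue_measure.
rewrite UE => cvgE.
apply: (@le_lt_trans _ _ (2 * Num.sqrt L)%:E); last exact: ltry.
apply: (cvge_le _ (cvgE _ _ _ _)).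
- by apply: nearW => n; exact: EE.
- apply/nondecreasing_seqP => n; apply/subsetPset => y.
  rewrite /E /= !in_itv /= => /andP[h ->]; rewrite andbT.
  by rewrite (le_trans _ h) // ler_pM2l // lef_pV2 ?posrE ?ler_nat.
- by move=> n; exact: measurable_itv.
- by move=> n; apply: mf; exact: measurable_itv.
- by move=> n y _; rewrite lee_fin invr_ge0 sqrtr_ge0.
Qed.

Section gwo_term_law.
Variables (R : realType) (a p x : R) (e02 : 0 < 2 :> R).
Hypothesis a0 : 0 < a.
Hypothesis px : 0 < `|p| + `|x - p|.

Definition gwo_radius (c : R) : R := a * `|c * p - x|.

Lemma gwo_radius_ge0 c : 0 <= gwo_radius c.
Proof. by rewrite mulr_ge0 // ltW. Qed.

Lemma measurable_gwo_radius : measurable_fun setT gwo_radius.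
Proof.
apply: measurable_funM => //; apply: measurableT_comp => //.
by apply: measurable_funB => //; apply: measurable_funM.
Qed.

(** The radius vanishes only if [c p = x]: at most at one [c], since [p] and [x]
    are not both [0]. *)
Lemma gwo_radius_ae_gt0 : {ae uniform_prob e02, forall c, 0 < gwo_radius c}.
Proof.
exists [set x / p]; split.
- exact: measurable_set1.
- have /null_content_dominatesP dom := dominates_uniform_prob e02.
  by apply: dom; [exact: measurable_set1|exact: lebesgue_measure_set1].
- move=> c /= /negP; rewrite /gwo_radius pmulr_rgt0 // normr_gt0 subr_eq0 negbK.
  move=> /eqP cpx; have [p0|p0] := eqVneq p 0.
    by move: px; rewrite -cpx p0 mulr0 subrr normr0 addr0 ltxx.
  by rewrite -cpx mulfK.
Qed.
(** If [p = 0] the radius is constant.  Otherwise it is the absolute value of the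
    affine function [c |-> a p c - a x], and a change of variable reduces the
    claim to the integrability of [|y|^(-1/2)] near [0]. *)
Lemma integral_inv_sqrt_gwo_radius :
  (\int[uniform_prob e02]_c ((Num.sqrt (gwo_radius c))^-1)%:E < +oo)%E.
Proof.
have msq (D : set R) (f : R -> R) : measurable_fun setT f ->
    measurable_fun D (fun y => ((Num.sqrt (f y))^-1)%:E).
  move=> mf; apply/measurable_EFinP/measurable_funTS.
  apply: measurable_fun_ge0_inv; first by move=> c; rewrite sqrtr_ge0.
  apply: measurableT_comp => //.
  by apply: continuous_measurable_fun; exact: sqrt_continuous.
have [p0|p0] := eqVneq p 0.
  rewrite (_ : (fun c => _) = cst ((Num.sqrt (a * `|0 - x|))^-1)%:E).
    by rewrite integral_cst //= probability_setT mule1 ltry.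
  by apply/funext => c /=; rewrite /gwo_radius p0 mulr0.
rewrite integral_uniform //; last exact: (msq setT _ measurable_gwo_radius).
apply: lte_mul_pinfty => //.
(* [L] bounds the radius over the support [[0, 2]] of the law of [c]. *)
pose L := a * (2 * `|p| + `|x|).
have L0 : 0 < L.
  rewrite mulr_gt0 // ltr_wpDr // mulr_gt0 // normr_gt0 //.
pose F (y : R) := (fun y => ((Num.sqrt `|y|)^-1)%:E) \_ `[- L, L] y.
have mnorm : measurable_fun setT (fun y : R => `|y|) by exact: measurableT_comp.
have mF : measurable_fun setT F.
  apply/(measurable_restrictT _ _).1; first exact: measurable_itv.
  exact: msq.
have F0 y : (0 <= F y)%E.
  by rewrite /F patchE; case: ifP => // _; rewrite lee_fin invr_ge0 sqrtr_ge0.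
have ap0 : a * p != 0 by rewrite mulf_neq0 // gt_eqF.
apply: (@le_lt_trans _ _ (\int[lebesgue_measure]_c F (a * p * c + - (a * x))%R)%E).
  rewrite integral_mkcond; apply: ge0_le_integral => //.
  - move=> c _; apply: erestrict_ge0 => y _.
    by rewrite lee_fin invr_ge0 sqrtr_ge0.
  - by apply/(measurable_restrictT _ _).1 => //; exact: (msq _ _ measurable_gwo_radius).
  - by apply: (measurableT_comp mF); apply: measurable_funD.
  - move=> c _; rewrite patchE; case: ifPn => // /set_mem /=.
    rewrite in_itv /= => /andP[c0 c2].
    have rE : `|a * p * c - a * x| = gwo_radius c.
      by rewrite /gwo_radius -mulrA -mulrBr normrM gtr0_norm // (mulrC p).
    rewrite /F patchE mem_set ?rE //= in_itv /= -ler_norml rE /L.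
    rewrite ler_pM2l // (le_trans (ler_normB _ _)) // lerD2r normrM ger0_norm //.
    by rewrite ler_wpM2r.
rewrite ge0_integral_affine //; apply: lte_mul_pinfty => //.
pose F1 (y : R) := (fun y => ((Num.sqrt y)^-1)%:E) \_ `]0, L] y.
have mF1 : measurable_fun setT F1.
  apply/(measurable_restrictT _ _).1; first exact: measurable_itv.
  exact: msq.
have F10 y : (0 <= F1 y)%E.
  by apply: erestrict_ge0 => z _; rewrite lee_fin invr_ge0 sqrtr_ge0.
have mF1N : measurable_fun setT (fun y : R => F1 (-1 * y + 0)%R).
  by apply: (measurableT_comp mF1); apply: measurable_funD.
apply: (@le_lt_trans _ _ (\int[lebesgue_measure]_y (F1 y + F1 (-1 * y + 0)%R))%E).
  apply: ge0_le_integral => //.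
  - exact: emeasurable_funD.
  - move=> y _; rewrite /F /F1 !patchE !mem_setE !in_itv /= mulN1r addr0.
    have [y0|y0|<-] := ltrgtP 0 y.
    + rewrite oppr_gt0 ltNge (ltW y0) /= adde0 gtr0_norm //.
      by rewrite (le_trans _ (ltW y0)) // oppr_le0 ltW.
    + rewrite oppr_gt0 y0 /= add0e ltr0_norm // lerNl.
      by rewrite (ltW (lt_trans y0 L0)) andbT.
    + by rewrite oppr0 ltxx /= normr0 sqrtr0 invr0 adde0; case: ifP.
rewrite ge0_integralD // (ge0_integral_affine _ _ mF1 F10) //.
rewrite normrN1 invr1 mul1e -integral_mkcond lte_add_pinfty //;
  exact: integral_inv_sqrt_lt_pinfty.
Qed.

Lemma gwo_term_mixture d (T : measurableType d) (P : probability T R)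
    (A C : {RV P >-> R}) (aa : - a < a) (g : R -> \bar R) :
  (forall B, measurable B -> distribution P A B = uniform_prob aa B) ->
  (forall B, measurable B -> distribution P C B = uniform_prob e02 B) ->
  (forall B D, measurable B -> measurable D ->
    P (A @^-1` B `&` C @^-1` D) = (P (A @^-1` B) * P (C @^-1` D))%E) ->
  is_pdf P (gwo_term A C p x) g ->
  uniform_mixture (uniform_prob e02) gwo_radius p g.
Proof.
move=> hA hC hAC gX; have [mg g0 _] := gX; split => //.
- exact: measurable_gwo_radius.
- exact: gwo_radius_ge0.
move=> phi mphi phi0.
have mX : measurable_fun setT (gwo_term A C p x).
  apply: measurable_funD => //; apply: measurable_funM => //.
  apply: measurableT_comp => //; apply: measurable_funB => //.
  exact: measurable_funM.
rewrite (ge0_integral_pdf mX gX mphi phi0).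
pose f (z : R * R) := phi (p + z.1 * `|z.2 * p - x|).
have mf : measurable_fun setT f.
  apply: (measurableT_comp mphi).
  apply: measurable_funD => //; apply: measurable_funM => //.
  apply: measurableT_comp => //; apply: measurable_funB => //.
  exact: measurable_funM.
rewrite (ge0_integral_uniform_pair hA hC hAC mf (fun z => phi0 _)).
apply: ge0_ae_eq_integral => //.
- exact: (@measurable_fun_fubini_tonelli_G _ _ (measurableTypeR R)
    (measurableTypeR R) R (uniform_prob aa) f mf (fun z => phi0 _)).
- apply: measurable_interval_mean => //; first exact: gwo_radius_ge0.
  exact: measurable_gwo_radius.
- by move=> c _; apply: integral_ge0 => s _; exact: phi0.
- by move=> c _; apply: interval_mean_ge0 => //; exact: gwo_radius_ge0.
have := gwo_radius_ae_gt0.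
apply: filterS; first exact: (ae_filter_ringOfSetsType (uniform_prob e02)).
move=> c rc _.
rewrite /f /= uniform_mean_affine //.
by move: rc; rewrite /gwo_radius pmulr_rgt0.
Qed.

End gwo_term_law.
(** * Mixtures of centred uniform laws *)

Lemma interval_mean_reflect (R : realType) (phi : R -> \bar R) (b p r : R) :
  measurable_fun setT phi -> (forall y, 0 <= phi y)%E ->
  interval_mean (fun y => phi (b - y)%R) p r = interval_mean phi (b - p) r.
Proof.
move=> mphi phi0; rewrite /interval_mean; congr (_ * _)%E.
rewrite [RHS]integral_mkcond [LHS]integral_mkcond.
set F := (phi \_ _).
have mF : measurable_fun [set: R] F.
  by apply/(measurable_restrictT _ _).1; [exact: measurable_itv|exact: measurable_funTS].
have F0 y : (0 <= F y)%E by apply: erestrict_ge0.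
have := ge0_integral_affine b (_ : -1 != 0) mF F0.
rewrite oppr_eq0 oner_eq0 normrN1 invr1 mul1e => <- //.
apply: eq_integral => y _; rewrite /F !patchE !mem_setE !in_itv /=.
rewrite mulN1r (addrC _ b).
congr (if _ then _ else _).
by apply/idP/idP => /andP[h1 h2]; apply/andP; split; lra.
Qed.

Lemma integral_itv_indic (R : realType) (D : set R) (g : R -> \bar R) :
  measurable D ->
  (\int[lebesgue_measure]_(y in D) g y =
   \int[lebesgue_measure]_y ((\1_D y)%:E * g y))%E.
Proof.
move=> mD; rewrite integral_mkcond; apply: eq_integral => y _.
by rewrite patchE indicE; case: ifP => _; rewrite ?mul1e ?mul0e.
Qed.

Lemma measurable_indicE (R : realType) (D : set R) : measurable D ->
  measurable_fun [set: R] (fun y => (\1_D y)%:E : \bar R).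
Proof. by move=> mD; apply/measurable_EFinP. Qed.

Section uniform_mixture_theory.
Context d (Y : measurableType d) (R : realType).
Variables (mu : probability Y R) (r : Y -> R) (p : R) (g : R -> \bar R).
Hypothesis hg : uniform_mixture mu r p g.

Lemma uniform_mixture_convolution (phi : R -> \bar R) (u : R) :
  measurable_fun setT phi -> (forall y, 0 <= phi y)%E ->
  convolution phi g u = (\int[mu]_c interval_mean phi (u - p) (r c))%E.
Proof.
move=> mphi phi0; have [_ _ _ _ E] := hg.
have mphiu : measurable_fun [set: R] (fun y : R => phi (u - y)).
  by apply: (measurableT_comp mphi); apply: measurable_funB.
rewrite /convolution (E (fun y => phi (u - y)) mphiu (fun y => phi0 _)).
by apply: eq_integral => c _; rewrite (interval_mean_reflect _ _ _ mphi phi0).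
Qed.

Lemma uniform_mixture_mass_reflect (w s : R) :
  (\int[lebesgue_measure]_(y in `[(2 * p - w - s)%R, (2 * p - w + s)%R]) g y =
   \int[lebesgue_measure]_(y in `[(w - s)%R, (w + s)%R]) g y)%E.
Proof.
have [_ _ _ _ E] := hg.
pose D (v : R) : set R := `[v - s, v + s]%classic.
have mD v : measurable (D v) by exact: measurable_itv.
have I0 v (y : R) : (0 <= (\1_(D v) y)%:E :> \bar R)%E by rewrite lee_fin.
rewrite (integral_itv_indic g (mD (2 * p - w))) (integral_itv_indic g (mD w)).
rewrite (E _ (measurable_indicE (mD w)) (I0 w)).
rewrite (E _ (measurable_indicE (mD (2 * p - w))) (I0 _)).
apply: eq_integral => c _.
have pE : 2 * p - p = p by ring.
transitivity (interval_mean (fun y => (\1_(D w) y)%:E) (2 * p - p) (r c));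
  last by rewrite pE.
rewrite -(interval_mean_reflect _ _ _ (measurable_indicE (mD w)) (I0 w)).
congr (interval_mean _ _ _); apply/funext => y.
rewrite !indicE !mem_setE !in_itv /=; congr (_%:R%:E); congr nat_of_bool.
by apply/idP/idP => /andP[h1 h2]; apply/andP; split; lra.
Qed.

Lemma uniform_mixture_integral_le1 : (\int[lebesgue_measure]_y g y <= 1)%E.
Proof.
have [mg g0 mr r0 E] := hg.
under eq_integral do rewrite -[g _]mul1e.
rewrite (E (cst 1%E) (measurable_cst _)) //.
apply: (@le_trans _ _ (\int[mu]_c cst 1%E c)%E); last first.
  rewrite integral_cst //. rewrite mul1e; exact: probability_le1.
apply: ge0_le_integral => //.
- by move=> c _; apply: interval_mean_ge0.
- exact: measurable_interval_mean.
move=> c _; rewrite /interval_mean integral_cst //= mul1e lebesgue_measure_itv /=.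
rewrite lte_fin; case: ifPn => rc; last by rewrite mule0.
rewrite -EFinB -EFinM lee_fin.
have rc0 : 0 < r c by lra.
rewrite (_ : _ - _ = 2 * r c); last by ring.
by rewrite mulVf // mulf_neq0 // ?pnatr_eq0 // gt_eqF.
Qed.

Hypothesis r_sqrt : (\int[mu]_c ((Num.sqrt (r c))^-1)%:E < +oo)%E.

Lemma measurable_inv_sqrt_radius :
  measurable_fun setT (fun c => (Num.sqrt (r c))^-1).
Proof.
have [mg g0 mr r0 E] := hg.
apply: measurable_fun_ge0_inv; first by move=> c; rewrite sqrtr_ge0.
apply: measurableT_comp => //.
by apply: continuous_measurable_fun; exact: sqrt_continuous.
Qed.

Lemma integrable_inv_sqrt_radius :
  mu.-integrable setT (fun c => ((Num.sqrt (r c))^-1)%:E).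
Proof.
apply/integrableP; split.
  exact/measurable_EFinP/measurable_inv_sqrt_radius.
under eq_integral do rewrite gee0_abs ?lee_fin ?invr_ge0 ?sqrtr_ge0 //.
exact: r_sqrt.
Qed.

(** An interval of half-width [r] meets an interval of half-width [s] in a set of
    measure at most [2 min(r, s) <= 2 sqrt(r s)], a fraction at most
    [sqrt(s / r)] of the former. *)
Lemma uniform_mixture_mass_le : exists K : R, forall w s : R, 0 <= s ->
  (\int[lebesgue_measure]_(y in `[(w - s)%R, (w + s)%R]) g y <=
   (K * Num.sqrt s)%:E)%E.
Proof.
have [mg g0 mr r0 E] := hg.
have sq0 c : (0 <= ((Num.sqrt (r c))^-1)%:E)%E.
  by rewrite lee_fin invr_ge0 sqrtr_ge0.
exists (fine (\int[mu]_c ((Num.sqrt (r c))^-1)%:E)%E).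
move=> w s s0; rewrite mulrC EFinM fineK; last first.
  by rewrite ge0_fin_numE ?integral_ge0.
rewrite -ge0_integralZl //; last first.
  exact/measurable_EFinP/measurable_inv_sqrt_radius.
have mI :=
  @measurable_indicE R `[w - s, w + s]%classic (measurable_itv _).
rewrite (integral_itv_indic g (measurable_itv _)) (E _ mI) //.
apply: ge0_le_integral => //.
- by move=> c _; apply: interval_mean_ge0.
- exact: measurable_interval_mean.
- apply/measurable_EFinP/measurable_funM => //.
  exact: measurable_inv_sqrt_radius.
move=> c _; rewrite /interval_mean integral_indic //.
have [->|rc] := eqVneq (r c) 0.
  by rewrite mulr0 invr0 sqrtr0 invr0 mul0e mule0.
have rc0 : 0 < r c by rewrite lt_neqAle eq_sym rc r0.
have itvE (b t : R) : 0 <= t ->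
    (lebesgue_measure (`[(b - t)%R, (b + t)%R]%classic : set R) <= (2 * t)%:E)%E.
  move=> t0; rewrite lebesgue_measure_itv /= lte_fin; case: ifPn => _.
    by rewrite -EFinB lee_fin; lra.
  by rewrite lee_fin mulr_ge0.
set I := (X in (_ * X <= _)%E).
have Ir : (I <= (2 * r c)%:E)%E.
  apply: le_trans (itvE p (r c) (r0 c)).
  by apply: le_measure; rewrite ?inE //; apply: measurableI.
have Is : (I <= (2 * s)%:E)%E.
  apply: le_trans (itvE w s s0).
  by apply: le_measure; rewrite ?inE //; apply: measurableI.
set q := Num.sqrt s; set t := Num.sqrt (r c).
have q0 : 0 <= q by rewrite sqrtr_ge0.
have t0 : 0 < t by rewrite sqrtr_gt0.
have sE : s = q ^+ 2 by rewrite sqr_sqrtr.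
have rE : r c = t ^+ 2 by rewrite sqr_sqrtr.
have Iqt : (I <= (2 * (q * t))%:E)%E.
  have [qt|tq] := leP q t.
  - apply: le_trans Is _; rewrite lee_fin ler_pM2l // sE expr2.
    exact: ler_wpM2l.
  - apply: le_trans Ir _; rewrite lee_fin ler_pM2l // rE expr2.
    by rewrite ler_pM2r // ltW.
apply: (@le_trans _ _ ((2 * r c)^-1%:E * (2 * (q * t))%:E)%E).
  by apply: lee_wpmul2l => //; rewrite lee_fin invr_ge0 mulr_ge0.
rewrite -!EFinM lee_fin le_eqVlt; apply/orP; left; apply/eqP.
by rewrite rE; field; rewrite gt_eqF.
Qed.

End uniform_mixture_theory.
(** * Convolution of nonnegative functions *)

Section convolution_theory.
Context (R : realType).
Implicit Types f g h : R -> \bar R.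

Lemma convolution_ge0 f g u :
  (forall y, 0 <= f y)%E -> (forall y, 0 <= g y)%E ->
  (0 <= convolution f g u)%E.
Proof. by move=> f0 g0; apply: integral_ge0 => y _; rewrite mule_ge0. Qed.

Lemma measurable_shift f : measurable_fun setT f ->
  measurable_fun setT (fun z : measurableTypeR R * measurableTypeR R => f (z.1 - z.2)%R).
Proof.
move=> mf; apply: (measurableT_comp mf).
by apply: (@measurable_funB _ (measurableTypeR R * measurableTypeR R)%type R).
Qed.

Lemma measurable_convolution f g :
  measurable_fun setT f -> measurable_fun setT g ->
  (forall y, 0 <= f y)%E -> (forall y, 0 <= g y)%E ->
  measurable_fun setT (convolution f g).
Proof.
move=> mf mg f0 g0.
pose F (z : measurableTypeR R * measurableTypeR R) := (f (z.1 - z.2)%R * g z.2)%E.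
apply: (@measurable_fun_fubini_tonelli_F _ _ (measurableTypeR R) (measurableTypeR R)
  R lebesgue_measure F).
- by apply: emeasurable_funM; [exact: measurable_shift|exact: measurableT_comp].
- by move=> z; rewrite mule_ge0.
Qed.

Lemma convolutionC f g :
  measurable_fun setT f -> measurable_fun setT g ->
  (forall y, 0 <= f y)%E -> (forall y, 0 <= g y)%E ->
  convolution f g = convolution g f.
Proof.
move=> mf mg f0 g0; apply/funext => u; rewrite /convolution.
have mF : measurable_fun [set: R] (fun y => f (u - y)%R * g y)%E.
  apply: emeasurable_funM => //; apply: (measurableT_comp mf).
  exact: measurable_funB.
have F0 y : (0 <= f (u - y)%R * g y)%E by rewrite mule_ge0.
have := ge0_integral_affine u (_ : -1 != 0) mF F0.
rewrite oppr_eq0 oner_eq0 normrN1 invr1 mul1e => <- //.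
apply: eq_integral => y _; rewrite muleC; congr (g _ * f _)%E; ring.
Qed.

(** Tonelli's theorem alone exchanges the last two factors; with
    [convolutionC] this brings any of the three factors to the end. *)
Lemma convolution_swap f g h :
  measurable_fun setT f -> measurable_fun setT g -> measurable_fun setT h ->
  (forall y, 0 <= f y)%E -> (forall y, 0 <= g y)%E -> (forall y, 0 <= h y)%E ->
  convolution (convolution f g) h = convolution (convolution f h) g.
Proof.
move=> mf mg mh f0 g0 h0; apply/funext => u; rewrite /convolution.
have mfu v : measurable_fun [set: R] (fun y => f (v - y)%R).
  by apply: (measurableT_comp mf); exact: measurable_funB.
transitivity (\int[lebesgue_measure]_z \int[lebesgue_measure]_y
    (f (u - z - y)%R * g y * h z))%E.
  apply: eq_integral => z _; rewrite ge0_integralZr //.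
  - by apply: emeasurable_funM => //; exact: mfu.
  - by move=> y _; rewrite mule_ge0.
pose F (x : measurableTypeR R * measurableTypeR R) :=
  (f (u - x.1 - x.2)%R * g x.2 * h x.1)%E.
have mF : measurable_fun setT F.
  apply: emeasurable_funM; last exact: measurableT_comp.
  apply: emeasurable_funM; last exact: measurableT_comp.
  apply: (measurableT_comp mf).
  apply: (@measurable_funB _ (measurableTypeR R * measurableTypeR R)%type R) => //.
  exact: (@measurable_funB _ (measurableTypeR R * measurableTypeR R)%type R).
have F0 x : (0 <= F x)%E by rewrite !mule_ge0.
rewrite (fubini_tonelli (m1 := lebesgue_measure) (m2 := lebesgue_measure) F mF F0).
apply: eq_integral => y _; rewrite -ge0_integralZr //.
- apply: eq_integral => z _; rewrite /F /= muleAC; congr (f _ * _ * _)%E; ring.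
- by apply: emeasurable_funM => //; exact: mfu.
- by move=> z _; rewrite mule_ge0.
Qed.

Lemma integral_convolution f g :
  measurable_fun setT f -> measurable_fun setT g ->
  (forall y, 0 <= f y)%E -> (forall y, 0 <= g y)%E ->
  (\int[lebesgue_measure]_u convolution f g u =
   \int[lebesgue_measure]_y f y * \int[lebesgue_measure]_y g y)%E.
Proof.
move=> mf mg f0 g0.
pose F (z : measurableTypeR R * measurableTypeR R) := (f (z.1 - z.2)%R * g z.2)%E.
have mF : measurable_fun setT F.
  by apply: emeasurable_funM; [exact: measurable_shift|exact: measurableT_comp].
have F0 z : (0 <= F z)%E by rewrite mule_ge0.
have -> := fubini_tonelli (m1 := lebesgue_measure) (m2 := lebesgue_measure) F mF F0.
rewrite -ge0_integralZl //; last exact: integral_ge0.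
apply: eq_integral => y _; rewrite /F /= ge0_integralZr //; last first.
  by apply: (measurableT_comp mf); exact: measurable_funB.
congr (_ * _)%E.
have := ge0_integral_affine (- y) (oner_neq0 R) mf f0.
rewrite normr1 invr1 mul1e => <-.
by apply: eq_integral => z _; rewrite mul1r.
Qed.

End convolution_theory.
(** * The convolution of two mixtures is continuous *)

Lemma continuous_sqrt_modulus (R : realType) (f : R -> R) (K : R) :
  (forall w v, `|f w - f v| <= K * Num.sqrt `|w - v|) -> continuous f.
Proof.
move=> fK w.
have sq : (K * Num.sqrt `|v - w| : R) @[v --> w] --> (0 : R).
  rewrite -[X in _ --> X](_ : K * Num.sqrt `|w - w| = 0); last first.
    by rewrite subrr normr0 sqrtr0 mulr0.
  apply: cvgM; first exact: cvg_cst.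
  apply: (@continuous_comp _ _ _ (fun v => `|v - w|) (@Num.sqrt R)); last first.
    exact: sqrt_continuous.
  apply: (@continuous_comp _ _ _ (fun v => v - w) (@Num.norm _ R)); last first.
    exact: norm_continuous.
  by apply: cvgB; [exact: cvg_id|exact: cvg_cst].
suff : (f v - f w) @[v --> w] --> (0 : R) by move/subr_cvg0.
apply: norm_cvg0.
apply: (squeeze_cvgr _ (cvg_cst (0 : R)) sq).
by apply: nearW => v; rewrite normr_ge0 fK.
Qed.

Lemma ge0_integral_setU_le d (T : measurableType d) (R : realType)
    (mu : {measure set T -> \bar R}) (A B : set T) (f : T -> \bar R) :
  measurable A -> measurable B -> measurable_fun setT f ->
  (forall x, 0 <= f x)%E ->
  (\int[mu]_(x in A `|` B) f x <= \int[mu]_(x in A) f x + \int[mu]_(x in B) f x)%E.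
Proof.
move=> mA mB mf f0.
have -> : A `|` B = A `|` (B `\` A) by rewrite setUDr setDv setD0.
rewrite ge0_integral_setU //.
- apply: leeD => //; apply: ge0_subset_integral => //; first exact: measurableD.
    exact: measurable_funTS.
- exact: measurableD.
- exact: measurable_funTS.
- by apply/disj_setPS => x [Ax []].
Qed.

Section two_mixtures.
Context d1 d2 (Y1 : measurableType d1) (Y2 : measurableType d2) (R : realType).
Variables (mu1 : probability Y1 R) (r1 : Y1 -> R) (p1 : R) (g1 : R -> \bar R).
Variables (mu2 : probability Y2 R) (r2 : Y2 -> R) (p2 : R) (g2 : R -> \bar R).
Hypothesis hg1 : uniform_mixture mu1 r1 p1 g1.
Hypothesis hg2 : uniform_mixture mu2 r2 p2 g2.
Hypothesis r1_sqrt : (\int[mu1]_c ((Num.sqrt (r1 c))^-1)%:E < +oo)%E.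
Hypothesis r2_sqrt : (\int[mu2]_c ((Num.sqrt (r2 c))^-1)%:E < +oo)%E.

Local Notation mass w s :=
  (\int[lebesgue_measure]_(y in `[(w - s)%R, (w + s)%R]) g1 y)%E.

(** Moving the centre of an interval from [v] to [w] adds at most the points
    within [|w - v|] of one of the two end points, hence at most twice the mass
    of an interval of half-width [|w - v|]. *)
Lemma uniform_mixture_mass_modulus : exists K : R,
  [/\ forall w s : R, 0 <= s -> 0 <= fine (mass w s) <= K * Num.sqrt s,
      forall w s : R, 0 <= s -> mass w s \is a fin_num &
      forall s : R, 0 <= s -> forall w v,
        `|fine (mass w s) - fine (mass v s)| <= (2 * K) * Num.sqrt `|w - v|].
Proof.
have [mg g0 _ _ _] := hg1.
have [K massK] := uniform_mixture_mass_le hg1 r1_sqrt.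
have mass0 w s : (0 <= mass w s)%E by apply: integral_ge0.
have massfin w s : 0 <= s -> mass w s \is a fin_num.
  by move=> s0; rewrite ge0_fin_numE // (le_lt_trans (massK w s s0)) // ltry.
exists K; split=> [w s s0|//|s s0].
  by rewrite fine_ge0 //= -lee_fin fineK ?massK // massfin.
have half w v : fine (mass w s) - fine (mass v s) <= (2 * K) * Num.sqrt `|w - v|.
  set e := `|w - v|.
  have e0 : 0 <= e by exact: normr_ge0.
  rewrite lerBlDl -lee_fin fineK ?massfin //.
  have -> : 2 * K * Num.sqrt e = K * Num.sqrt e + K * Num.sqrt e by ring.
  rewrite addrA 2!EFinD fineK ?massfin //.
  pose A := `[(v - s)%R, (v + s)%R]%classic : set R.
  pose B := `[(w - s - e)%R, (w - s + e)%R]%classic : set R.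
  pose D := `[(w + s - e)%R, (w + s + e)%R]%classic : set R.
  have mA : measurable A by exact: measurable_itv.
  have mB : measurable B by exact: measurable_itv.
  have mD : measurable D by exact: measurable_itv.
  have mAB : measurable (A `|` B) by exact: measurableU.
  have sub X1 X2 : measurable X1 -> measurable X2 ->
      (\int[lebesgue_measure]_(y in X1 `|` X2) g1 y <=
       \int[lebesgue_measure]_(y in X1) g1 y +
       \int[lebesgue_measure]_(y in X2) g1 y)%E.
    by move=> mX1 mX2; apply: ge0_integral_setU_le => //; exact: measurable_funTS.
  apply: (@le_trans _ _ (\int[lebesgue_measure]_(y in A `|` B `|` D) g1 y)%E).
    apply: ge0_subset_integral => //.
    - exact: measurableU.
    - exact: measurable_funTS.
    move=> y; rewrite /A /B /D /= !in_itv /= => /andP[h1 h2].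
    have : v - w <= e /\ w - v <= e.
      by rewrite /e; split; [rewrite distrC|]; exact: ler_norm.
    case=> h3 h4.
    have [y1|y1] := leP (v - s) y; last by left; right; apply/andP; split; lra.
    have [y2|y2] := leP y (v + s); first by left; left; apply/andP; split; lra.
    by right; apply/andP; split; lra.
  apply: (le_trans (sub _ _ mAB mD)).
  apply: leeD; last exact: massK.
  apply: (le_trans (sub _ _ mA mB)).
  by apply: leeD => //; exact: massK.
move=> w v; rewrite ler_norml half andbT lerNl opprB distrC; exact: half.
Qed.

(** The convolution is the integral over [c] of
    [F u c = (2 r)^-1 * mass (u - p2) r] with [r = r2 c].  It is continuous in
    [u] for each [c] and dominated by [K / 2 * r^(-1/2)], which is integrable. *)
Lemma convolution_uniform_mixtures : exists gam : R -> R,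
  [/\ convolution g1 g2 = EFin \o gam, continuous gam,
      (exists B, forall u, 0 <= gam u <= B),
      forall u, gam (2 * (p1 + p2) - u) = gam u &
      lebesgue_measure.-integrable setT (EFin \o gam)].
Proof.
have [mg1 g10 _ _ _] := hg1; have [mg2 g20 mr2 r20 _] := hg2.
have [K [massK massfin massmod]] := uniform_mixture_mass_modulus.
pose F u c := (2 * r2 c)^-1 * fine (mass (u - p2) (r2 c)).
have FE u c : interval_mean g1 (u - p2) (r2 c) = (F u c)%:E.
  by rewrite /F EFinM fineK // massfin.
have mF u : measurable_fun setT (F u).
  have := measurable_interval_mean (u - p2) r20 mr2 mg1 g10.
  by move=> /(eq_measurable_fun _ (fun c _ => FE u c)) /measurable_EFinP.
have F0 u c : 0 <= F u c.
  have /andP[m0 _] := massK (u - p2) _ (r20 c).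
  by rewrite mulr_ge0 // invr_ge0 mulr_ge0.
pose H c := K / 2 * (Num.sqrt (r2 c))^-1.
have FH u c : F u c <= H c.
  have /andP[_ mK] := massK (u - p2) _ (r20 c).
  have [r0|rc] := eqVneq (r2 c) 0.
    by rewrite /F /H r0 mulr0 invr0 mul0r sqrtr0 invr0 mulr0.
  have rc0 : 0 < r2 c by rewrite lt_neqAle eq_sym rc r20.
  apply: (@le_trans _ _ ((2 * r2 c)^-1 * (K * Num.sqrt (r2 c)))).
    by apply: ler_wpM2l => //; rewrite invr_ge0 mulr_ge0.
  have t0 : 0 < Num.sqrt (r2 c) by rewrite sqrtr_gt0.
  rewrite /H -{1}(sqr_sqrtr (r20 c)); move: t0; move: (Num.sqrt _) => t t0.
  rewrite le_eqVlt; apply/orP; left; apply/eqP; field.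
  by rewrite gt_eqF.
have intH : mu2.-integrable setT (EFin \o H).
  have := integrableZl measurableT (K / 2) (integrable_inv_sqrt_radius hg2 r2_sqrt).
  by apply: eq_integrable => // c _; rewrite /= EFinM.
have intF u : mu2.-integrable setT (EFin \o F u).
  apply: (le_integrable measurableT _ _ intH).
    exact/measurable_EFinP.
  move=> c _; rewrite /= lee_fin ger0_norm // ger0_norm ?FH //.
  exact: le_trans (FH u c).
pose gam u := \int[mu2]_c F u c.
have convE : convolution g1 g2 = EFin \o gam.
  apply/funext => u; rewrite (uniform_mixture_convolution hg2) // /gam /=.
  rewrite /Rintegral fineK; last exact: (integrable_fin_num measurableT (intF u)).
  by apply: eq_integral => c _; rewrite FE.
have gam0 u : 0 <= gam u by apply: Rintegral_ge0 => c _; exact: F0.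
exists gam; split; [exact: convE| | | |].
- move=> u.
  have ucont : {in `]u - 1, u + 1[%classic,
      continuous (fun l : R => \int[mu2]_(c in setT) F l c)}.
    apply: (@continuity_under_integral _ _ _ mu2 F setT _ _ _ _ _ H) => //.
    + apply: aeW => c _ v _; apply: cvgM; first exact: cvg_cst.
      apply: (@continuous_sqrt_modulus _ (fun v => fine (mass (v - p2) (r2 c))) (2 * K)).
      move=> w w'; apply: le_trans (massmod _ (r20 c) _ _) _.
      by rewrite opprB addrA subrK.
    + by move=> v _; apply: aeW => c _; rewrite ger0_norm.
  by apply: ucont; rewrite inE /= in_itv /=; apply/andP; split; lra.
- exists (\int[mu2]_c H c) => u; rewrite gam0 /=.
  by apply: le_Rintegral => // c _; exact: FH.
- move=> u; apply: eq_Rintegral => c _; rewrite /F; congr (_ * fine _).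
  rewrite -(uniform_mixture_mass_reflect hg1 (u - p2) (r2 c)).
  by have -> : 2 * (p1 + p2) - u - p2 = 2 * p1 - (u - p2) by ring.
- apply/integrableP; split.
    by rewrite -convE; exact: measurable_convolution.
  have -> : (\int[lebesgue_measure]_u `|(EFin \o gam) u| =
      \int[lebesgue_measure]_u convolution g1 g2 u)%E.
    by apply: eq_integral => u _; rewrite convE /= ger0_norm.
  rewrite integral_convolution //.
  have i1 := uniform_mixture_integral_le1 hg1.
  have i2 := uniform_mixture_integral_le1 hg2.
  apply: (@le_lt_trans _ _ (1 * 1)%E); last by rewrite mule1 ltry.
  by apply: lee_pmul => //; exact: integral_ge0.
Qed.

End two_mixtures.
(** * Convolving with a mixture whose radii are bounded below *)

(** Truncating the radius changes it on a null set only, and gives a lower bound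
    that holds everywhere, as differentiation under the integral sign
    requires. *)
Lemma uniform_mixture_ae_ge d (Y : measurableType d) (R : realType)
    (mu : probability Y R) (r : Y -> R) (p delta : R) (g : R -> \bar R) :
  0 < delta -> {ae mu, forall c, delta <= r c} ->
  uniform_mixture mu r p g ->
  uniform_mixture mu (fun c => Num.max delta (r c)) p g.
Proof.
move=> d0 dr [mg g0 mr r0 E]; split => //.
- exact: measurable_maxr.
- by move=> c; rewrite le_max ltW.
move=> phi mphi phi0; rewrite (E phi mphi phi0).
apply: ge0_ae_eq_integral => //.
- exact: measurable_interval_mean.
- apply: measurable_interval_mean => //; last exact: measurable_maxr.
  by move=> c; rewrite le_max ltW.
- by move=> c _; exact: interval_mean_ge0.
- by move=> c _; apply: interval_mean_ge0 => //; rewrite le_max ltW.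
move: dr; apply: filterS.
by move=> c dr _; rewrite max_r.
Qed.

(** Integrability allows the base point [-oo], hence a single primitive on the
    whole line. *)
Lemma continuous_integrable_primitive (R : realType) (f : R -> R) :
  continuous f -> lebesgue_measure.-integrable setT (EFin \o f) ->
  exists2 F : R -> R, (forall x, is_derive (x : R) 1 F (f x)) &
    forall a b : R, a < b ->
      (\int[lebesgue_measure]_(y in `[a, b]) (f y)%:E = (F b - F a)%:E)%E.
Proof.
move=> cf intf.
pose F (x : R) := \int[lebesgue_measure]_(t in `]-oo, x]) f t.
have dF (x : R) : derivable F x 1 /\ derive1 F x = f x.
  apply: (@continuous_FTC1 _ f -oo%O x (x + 1)).
  - by rewrite ltrDl.
  - by apply: integrableS intf.
  - by rewrite ltNyr.
  - exact: cf.
have cF (x : R) : {for x, continuous F}.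
  apply: differentiable_continuous; apply/derivable1_diffP; exact: (dF x).1.
exists F => [x|a b ab].
  split; first exact: (dF x).1.
  by rewrite -derive1E; exact: (dF x).2.
rewrite (@continuous_FTC2 _ f F) ?EFinB //.
- exact: continuous_subspaceT.
- split.
  + by move=> x _; exact: (dF x).1.
  + exact: cvg_at_right_filter (cF a).
  + exact: cvg_at_left_filter (cF b).
- by move=> x _; exact: (dF x).2.
Qed.

Section convolution_derivable.
Context d (Y : measurableType d) (R : realType).
Variables (mu : probability Y R) (r : Y -> R) (p delta : R) (g : R -> \bar R).
Variables (gam : R -> R) (B : R).
Hypothesis hg : uniform_mixture mu r p g.
Hypothesis delta0 : 0 < delta.
Hypothesis delta_r : forall c, delta <= r c.
Hypothesis gam_cont : continuous gam.
Hypothesis gam_int : lebesgue_measure.-integrable setT (EFin \o gam).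
Hypothesis gamB : forall u, 0 <= gam u <= B.

(** The convolution is the integral over [c] of
    [(2 r)^-1 * (Gam (u - p + r) - Gam (u - p - r))] with [Gam' = gam], whose
    derivative in [u] is bounded by [(2 delta)^-1 * B]. *)
Lemma convolution_derivable : exists2 eta : R -> R,
  convolution (EFin \o gam) g = EFin \o eta & forall u, derivable eta u 1.
Proof.
have [mg g0 mr r0 _] := hg.
have rpos c : 0 < r c by exact: lt_le_trans (delta_r c).
have [Gam dGam intGam] := continuous_integrable_primitive gam_cont gam_int.
pose F u c := (2 * r c)^-1 * (Gam (u - p + r c) - Gam (u - p - r c)).
have mgam : measurable_fun [set: R] (EFin \o gam) by have [] := integrableP _ _ _ gam_int.
have gam0 u : (0 <= (EFin \o gam) u)%E.
  by rewrite lee_fin; have /andP[] := gamB u.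
have FE u c : interval_mean (EFin \o gam) (u - p) (r c) = (F u c)%:E.
  rewrite /interval_mean /= intGam ?EFinM //.
  by have := rpos c; lra.
have mF u : measurable_fun setT (F u).
  have := measurable_interval_mean (u - p) r0 mr mgam gam0.
  by move=> /(eq_measurable_fun _ (fun c _ => FE u c)) /measurable_EFinP.
have F0 u c : 0 <= F u c.
  by rewrite -lee_fin -FE; apply: interval_mean_ge0.
have B0 : 0 <= B by have /andP[] := gamB 0; exact: le_trans.
have dF u c : is_derive (u : R) 1 (F ^~ c)
    ((2 * r c)^-1 * (gam (u - p + r c) - gam (u - p - r c))).
  have dshift (k : R) : is_derive (u : R) 1 (fun v => Gam (v - p + k)) (gam (u - p + k)).
    have dk : is_derive (u : R) 1 (fun v : R => v - p + k) 1.
      by apply: is_derive_eq; rewrite subr0 addr0.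
    have := @is_derive1_comp _ Gam (fun v => v - p + k) u _ _ (dGam _) dk.
    by rewrite mulr1.
  have d1 := dshift (r c); have d2 := dshift (- r c).
  rewrite /F; apply: is_derive_eq.
  by rewrite /GRing.scale /=; ring.
pose I := fine (\int[lebesgue_measure]_y (EFin \o gam) y)%E.
have Ifin : (\int[lebesgue_measure]_y (EFin \o gam) y)%E \is a fin_num.
  exact: integrable_fin_num.
have invr_le c : (2 * r c)^-1 <= (2 * delta)^-1.
  by rewrite lef_pV2 ?posrE ?mulr_gt0 // ler_pM2l.
have FI u c : F u c <= (2 * delta)^-1 * I.
  apply: ler_pM => //.
  - by rewrite invr_ge0 mulr_ge0.
  - rewrite -lee_fin -intGam; last by have := rpos c; lra.
    by apply: integral_ge0 => y _; exact: gam0.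
  rewrite -lee_fin -intGam; last by have := rpos c; lra.
  rewrite /I fineK //; by apply: ge0_subset_integral => // y _; exact: gam0.
have intF u : mu.-integrable setT (EFin \o F u).
  apply: (@le_integrable _ _ _ mu _ measurableT _ (cst ((2 * delta)^-1 * I)%:E)).
  - exact/measurable_EFinP.
  - move=> c _; rewrite /= lee_fin ger0_norm // ger0_norm ?FI //.
    exact: le_trans (FI u c).
  - exact: finite_measure_integrable_cst.
exists (fun u => \int[mu]_c F u c).
  apply/funext => u; rewrite (uniform_mixture_convolution hg) //=.
  rewrite /Rintegral fineK; last exact: (integrable_fin_num measurableT (intF u)).
  by apply: eq_integral => c _; rewrite FE.
move=> u.
apply: (@derivable_under_integral _ _ _ mu F setT measurableT u (u - 1) (u + 1)
  _ _ _ (fun _ => (2 * delta)^-1 * B)).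
- by rewrite /= in_itv /=; apply/andP; split; lra.
- by move=> v _; exact: intF.
- by move=> v c _ _; have [] := dF v c.
- by move=> c; rewrite mulr_ge0 // invr_ge0 mulr_ge0 // ltW.
- exact: finite_measure_integrable_cst.
move=> v c _ _; rewrite /partial1of2 derive1E.
have -> := @derive_val _ _ _ _ _ _ _ (dF v c).
rewrite normrM ger0_norm; last by rewrite invr_ge0 mulr_ge0.
apply: ler_pM => //; first by rewrite invr_ge0 mulr_ge0.
have /andP[h1 h2] := gamB (v - p + r c).
have /andP[h3 h4] := gamB (v - p - r c).
by rewrite ler_norml; apply/andP; split; lra.
Qed.
End convolution_derivable.
(** * Symmetry of the triple convolution *)

Lemma uniform_mixture_convolution_reflect d (Y : measurableType d) (R : realType)
    (mu : probability Y R) (r : Y -> R) (p q u : R) (g phi : R -> \bar R) :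
  uniform_mixture mu r p g ->
  measurable_fun setT phi -> (forall y, 0 <= phi y)%E ->
  (forall y, phi (2 * q - y) = phi y) ->
  convolution phi g (2 * (q + p) - u) = convolution phi g u.
Proof.
move=> hg mphi phi0 phiq.
rewrite !(uniform_mixture_convolution hg _ mphi phi0).
apply: eq_integral => c _.
have -> : 2 * (q + p) - u - p = 2 * q - (u - p) by ring.
rewrite -(interval_mean_reflect (2 * q) _ _ mphi phi0).
have phiE : (fun y : R => phi (2 * q - y)) = phi by apply/funext.
by rewrite [in LHS]phiE.
Qed.

(** Differentiating [f (2 c - u) = f u] at [c] gives [- f' c = f' c]. *)
Lemma derive1_even (R : realType) (f : R -> R) (c : R) :
  derivable f c 1 -> (forall u, f (2 * c - u) = f u) -> derive1 f c = 0.
Proof.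
move=> df fE.
have dr : is_derive (c : R) 1 (fun u : R => 2 * c - u) (-1).
  by apply: is_derive_eq; rewrite /GRing.scale /=; ring.
have df' : is_derive (2 * c - c : R) 1 f (derive1 f c).
  have -> : 2 * c - c = c by ring.
  by rewrite derive1E; split.
have := @is_derive1_comp _ f (fun u => 2 * c - u) c _ _ df' dr.
have -> : f \o (fun u : R => 2 * c - u) = f.
  by apply/funext => u; exact: fE.
move=> [_]; rewrite -derive1E mulrN1 => /eqP.
by rewrite -subr_eq0 opprK -mulr2n mulrn_eq0 /= => /eqP.
Qed.

Lemma convolution3_uniform_mixtures d1 d2 d3 (Y1 : measurableType d1)
    (Y2 : measurableType d2) (Y3 : measurableType d3) (R : realType)
    (mu1 : probability Y1 R) (mu2 : probability Y2 R) (mu3 : probability Y3 R)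
    (r1 : Y1 -> R) (r2 : Y2 -> R) (r3 : Y3 -> R) (p1 p2 p3 delta : R)
    (g1 g2 g3 : R -> \bar R) :
  uniform_mixture mu1 r1 p1 g1 -> uniform_mixture mu2 r2 p2 g2 ->
  uniform_mixture mu3 r3 p3 g3 ->
  (\int[mu1]_c ((Num.sqrt (r1 c))^-1)%:E < +oo)%E ->
  (\int[mu2]_c ((Num.sqrt (r2 c))^-1)%:E < +oo)%E ->
  0 < delta -> {ae mu3, forall c, delta <= r3 c} ->
  exists eta : R -> R,
    [/\ convolution (convolution g1 g2) g3 = EFin \o eta,
        forall u, derivable eta u 1 &
        forall u, eta (2 * (p1 + p2 + p3) - u) = eta u].
Proof.
move=> h1 h2 h3 s1 s2 d0 dr3.
have [gam [gamE gam_cont [B gamB] gam_sym gam_int]] :=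
  convolution_uniform_mixtures h1 h2 s1 s2.
have h3' := uniform_mixture_ae_ge d0 dr3 h3.
have dmax c : delta <= Num.max delta (r3 c) by rewrite le_max lexx.
have [eta etaE deta] := convolution_derivable h3' d0 dmax gam_cont gam_int gamB.
exists eta; split => //; first by rewrite gamE.
move=> u; apply: EFin_inj; rewrite -![(eta _)%:E]/((EFin \o eta) _) -etaE.
apply: (uniform_mixture_convolution_reflect _ h3) => //.
- by have [] := integrableP _ _ _ gam_int.
- by move=> y; rewrite lee_fin; have /andP[] := gamB y.
- by move=> y; rewrite /= gam_sym.
Qed.

(** For [0 <= c <= 2] the point [c p - x] is within [|p|] of [p - x], so its
    absolute value is at least [|x - p| - |p|]. *)
Lemma gwo_radius_ae_ge (R : realType) (a p x : R) (e02 : 0 < 2 :> R) : 0 < a ->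
  {ae uniform_prob e02, forall c, gwo_m a p x <= gwo_radius a p x c}.
Proof.
move=> a0; exists (~` `[0, 2]%classic); split.
- by apply: measurableC; exact: measurable_itv.
- rewrite /uniform_prob; apply: integral0_eq => c /=; rewrite in_itv /= => /negP.
  by rewrite /uniform_pdf => /negbTE ->.
move=> c /= h1 h2; apply: h1; move: h2; rewrite in_itv /= => /andP[c0 c2].
rewrite /gwo_m /gwo_radius ler_pM2l // addrC lerBlDr.
have -> : x - p = (c * p - p) - (c * p - x) by ring.
rewrite (le_trans (ler_normB _ _)) // addrC lerD2l.
have -> : c * p - p = (c - 1) * p by ring.
rewrite normrM ler_piMl // ler_norml; apply/andP; split; lra.
Qed.

Lemma mutually_independent_pair d (T : measurableType d) (R : realType)
    (P : probability T R) (I : finType) (X : I -> {RV P >-> R}) (i j : I)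
    (B D : set R) :
  mutually_independent X -> i != j -> measurable B -> measurable D ->
  P (X i @^-1` B `&` X j @^-1` D) = (P (X i @^-1` B) * P (X j @^-1` D))%E.
Proof.
move=> hX ij mB mD.
have := hX [set i; j]%SET (fun k => if k == i then B else D).
rewrite big_setU1 ?inE //= big_set1 eqxx eq_sym (negbTE ij) => <-.
- congr (P _); apply/seteqP; split => w.
    move=> [Bw Dw] k /=; rewrite !inE => /orP[/eqP ->|/eqP ->].
      by rewrite eqxx.
    by rewrite eq_sym (negbTE ij).
  move=> h; split.
    by have := h i; rewrite /= eqxx !inE eqxx; apply.
  by have := h j; rewrite /= eq_sym (negbTE ij) !inE eqxx orbT; apply.
- by move=> k _; case: ifP.
Qed.
Theorem corollary2p3 (R : realType) (d : measure_display)
  (T : measurableType d) (P : probability T R)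
  (t tmax : nat) (ht1 : (1 <= t)%N) (htT : (t < tmax)%N)
  (p : 'I_3 -> R) (x : R)
  (A C : 'I_3 -> {RV P >-> R})
  (hA : forall k, has_uniform_law (A k) (- gwo_a R t tmax) (gwo_a R t tmax))
  (hC : forall k, has_uniform_law (C k) 0 2)
  (hindep : mutually_independent
     (fun i : 'I_3 + 'I_3 => match i with inl k => A k | inr k => C k end))
  (g : 'I_3 -> R -> \bar R)
  (hg : forall k, is_pdf P (gwo_term (A k) (C k) (p k) x) (g k))
  (h : R -> \bar R)
  (hpdf : is_pdf P (gwo_next (fun k => A k) (fun k => C k) p x) h)
  (hconv : forall u, h u = (3%:E * convolution3 g (3 * u)%R)%E)
  (hn : forall k, 0 < gwo_n (gwo_a R t tmax) (p k) x)
  (hm : exists k, 0 < gwo_m (gwo_a R t tmax) (p k) x) :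
  [/\ forall u, h u \is a fin_num,
      forall u, derivable (fine \o h) u 1 &
      derive1 (fine \o h) (3^-1 * \sum_(k < 3) p k) = 0].
Proof.
set a := gwo_a R t tmax in hA hn hm.
have a0 : 0 < a.
  have [aa _] := hA ord0.
  by move: aa; rewrite -subr_gt0 opprK -mulr2n pmulrn_lgt0.
have px k : 0 < `|p k| + `|x - p k| by have := hn k; rewrite /gwo_n pmulr_rgt0.
have e02 : 0 < 2 :> R by [].
pose mu := uniform_prob e02; pose r k := gwo_radius a (p k) x.
have mix k : uniform_mixture mu (r k) (p k) (g k).
  have [aa hAk] := hA k; have [e02' hCk] := hC k.
  apply: (gwo_term_mixture a0 (px k) hAk _ _ (hg k)).
    by move=> B mB; rewrite hCk // (bool_irrelevance e02' e02).
  move=> B D mB mD.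
  exact: (mutually_independent_pair (i := inl k) (j := inr k) hindep).
have rs k : (\int[mu]_c ((Num.sqrt (r k c))^-1)%:E < +oo)%E.
  exact: integral_inv_sqrt_gwo_radius.
have mg k : measurable_fun setT (g k) by have [] := mix k.
have g0 k y : (0 <= g k y)%E by have [] := mix k.
(* It remains to bring a factor with [m > 0] to the last position. *)
have key i j k : 0 < gwo_m a (p k) x ->
    convolution3 g = convolution (convolution (g i) (g j)) (g k) ->
    \sum_(l < 3) p l = p i + p j + p k ->
  exists eta : R -> R, [/\ convolution3 g = EFin \o eta,
    forall u, derivable eta u 1 &
    forall u, eta (2 * \sum_(l < 3) p l - u) = eta u].
  move=> mk -> ->.
  exact: (convolution3_uniform_mixtures (mix i) (mix j) (mix k) (rs i) (rs j) mk
    (gwo_radius_ae_ge _ _ _ a0)).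
have sumE : \sum_(l < 3) p l = p 0 + p 1 + p 2.
  rewrite !big_ord_recl big_ord0 addr0 addrA.
  by congr (_ + p _ + p _); apply/val_inj.
have [eta [etaE deta eta_sym]] : exists eta : R -> R,
    [/\ convolution3 g = EFin \o eta, forall u, derivable eta u 1 &
    forall u, eta (2 * \sum_(l < 3) p l - u) = eta u].
  have [k mk] := hm.
  have : [|| k == 0, k == 1 | k == 2] by case: k {mk} => [[|[|[|]]]].
  case/or3P => /eqP kE; rewrite {}kE in mk.
  - apply: (key 1 2 0 mk); last by rewrite sumE; ring.
    by rewrite /convolution3 (convolutionC (mg 0)) // convolution_swap.
  - apply: (key 0 2 1 mk); last by rewrite sumE; ring.
    by rewrite /convolution3 convolution_swap.
  - by apply: (key 0 1 2 mk); rewrite ?sumE.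
have hE u : h u = (3 * eta (3 * u))%:E by rewrite hconv etaE.
have hfE : fine \o h = fun u => 3 * eta (3 * u).
  by apply/funext => u; rewrite /= hE.
have dh u : derivable (fine \o h) u 1.
  rewrite hfE.
  have d3 : is_derive (u : R) 1 (fun v : R => 3 * v) 3.
    by apply: is_derive_eq; rewrite /GRing.scale /=; ring.
  have deta3 : is_derive (3 * u : R) 1 eta (derive1 eta (3 * u)).
    by rewrite derive1E; split; [exact: deta|].
  have [dc _] := @is_derive1_comp _ eta (fun v => 3 * v) u _ _ deta3 d3.
  by apply: derivableM; [exact: derivable_cst|exact: dc].
split => [u|//|]; first by rewrite hE.
apply: derive1_even => // u.
rewrite hfE -(eta_sym (3 * u)); congr (3 * eta _).
by field.
Qed.
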